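(* Let $\mathfrak{B}$ be a bornology on a metric space $X$ with a closed base $\mathfrak{B}_0$ and let $\mathcal{I},\mathcal{J}$ be ideals on $\omega$. The following statements hold. (1) If $|\mathfrak{B}_0|<\lambda(\mathcal{I},\mathcal{J})$, then $X$ satisfies $\mathrm{S}_1(\mathcal{I}\text{-}\Gamma_{\mathfrak{B}^s},\mathcal{J}\text{-}\Gamma_{\mathfrak{B}^s})$. (2) If $|\mathfrak{B}_0|<\mathfrak{b}_{\mathcal{I}}$, then $X$ satisfies $\mathrm{S}_1(\Gamma_{\mathfrak{B}^s},\mathcal{I}\text{-}\Gamma_{\mathfrak{B}^s})$.
   Context: $(X,d)$ is an infinite metric space; $\omega$ is the set of natural numbers. A bornology $\mathfrak{B}$ on $X$ is a family of subsets of $X$ that is closed under subsets and finite unions and covers $X$. A base of $\mathfrak{B}$ is a subfamily $\mathfrak{B}_0\subseteq\mathfrak{B}$ such that every $B\in\mathfrak{B}$ is contained in some $B_0\in\mathfrak{B}_0$; it is a closed base if its members are closed. For $B\in\mathfrak{B}$, $\delta>0$: $B^\delta=\bigcup_{x\in B}\{y\in X:d(x,y)<\delta\}$. An ideal on $\omega$ is a family $\mathcal{I}\subseteq\mathcal{P}(\omega)$ closed under subsets and finite unions, containing all finite sets, with $\omega\notin\mathcal{I}$. $\mathcal{J}^+=\mathcal{P}(\omega)\setminus\mathcal{J}$. Covers of $X$ never contain $X$ as an element. An open cover $\{U_n:n\in\omega\}$ (with its enumeration) is a $\gamma_{\mathfrak{B}^s}$-cover if it is infinite and for each $B\in\mathfrak{B}$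 there are $n_0\in\omega$ and positive reals $\delta_n$ ($n\geq n_0$) with $B^{\delta_n}\subseteq U_n$ for all $n\geq n_0$; $\Gamma_{\mathfrak{B}^s}$ is the class of these. A countable open cover $\{U_n:n\in\omega\}$ (with its enumeration) is an $\mathcal{I}$-$\gamma_{\mathfrak{B}^s}$-cover if for each $B\in\mathfrak{B}$ there is a sequence $\{\delta_n\}$ of positive reals with $\{n\in\omega:B^{\delta_n}\nsubseteq U_n\}\in\mathcal{I}$; $\mathcal{I}\text{-}\Gamma_{\mathfrak{B}^s}$ is the class of these. $\mathrm{S}_1(\mathcal{A},\mathcal{B})$: for every sequence $\{A_n:n\in\omega\}$ of elements of $\mathcal{A}$ there are $a_n\in A_n$ ($n\in\omega$) such that $\{a_n:n\in\omega\}\in\mathcal{B}$ (for enumerated covers, with the enumeration $n\mapsto a_n$). $\lambda(\mathcal{I},\mathcal{J})$ is the minimum of $|\mathcal{A}|$ over $\mathcal{A}\subseteq{}^\omega\mathcal{I}$ such that for every $\phi\in{}^\omega\omega$ there is $\{B_n:n\in\omega\}\in\mathcal{A}$ with $\{n:\phi(n)\in B_n\}\in\mathcal{J}^+$. For $f,g\in{}^\omega\omega$, $f\leq_{\mathcal{I}}g$ means $\{n\in\omega:g(n)<f(n)\}\in\mathcal{I}$; a set $A\subseteq{}^\omega\omega$ is $\mathcal{I}$-bounded if some $g\in{}^\omega\omega$ satisfies $f\leq_{\mathcal{I}}g$ for all $f\in A$; $\mathfrak{b}_{\mathcal{I}}$ is the least cardinality of a subset of ${}^\omega\omega$ that is not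 $\mathcal{I}$-bounded. *)

(* Defs.v *)
From mathcomp Require Import all_boot all_order all_algebra.
From mathcomp Require Import all_classical all_reals all_analysis.

Set Implicit Arguments.
Unset Strict Implicit.
Unset Printing Implicit Defensive.

Import Order.TTheory GRing.Theory Num.Theory.

Local Open Scope classical_set_scope.
Local Open Scope card_scope.
Local Open Scope ring_scope.

Definition card_lt (T U : Type) (A : set T) (B : set U) : Prop :=
  (A #<= B) /\ (A #!= B).

Definition is_least_card (T : Type) (P : set (set T)) (A : set T) : Prop :=
  P A /\ forall A' : set T, P A' -> A #<= A'.

(* The least cardinality of a member of P, represented by a chosen member of
   P of that cardinality; by [least_cardP] one exists as soon as P is
   nonempty, and [lambda_attained] and [bnum_attained] below show that
   the default value set0 is never used. *)
Definition least_card (T : Type) (P : set (set T)) : set T :=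
  xget set0 [set A | is_least_card P A].

Lemma least_cardP (T : Type) (P : set (set T)) :
  P !=set0 -> is_least_card P (least_card P).
Proof.
move=> [A0 PA0]; apply: (@xgetPex _ _ [set A | is_least_card P A]).
(* A maximal set of choice functions on P that pairwise differ at every member
   of P surjects onto some member of P and injects into all of them. *)
pose Q : set (set (set T -> T)) := [set G |
  (forall f, G f -> forall A, P A -> A (f A)) /\
  (forall f g, G f -> G g -> forall A, P A -> f A = g A -> f = g)].
have [G [[Gin Ginj] Gmax]] : exists G, Q G /\ forall G', G `<` G' -> ~ Q G'.
  apply: Zorn_bigcup => F FQ Ftot; split.
    by move=> f [G FG Gf]; have [h _] := FQ _ FG; exact: h.
  move=> f g [G FG Gf] [H FH Hg].
  have [GH|HG] := Ftot _ _ FG FH.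
    by have [_ h] := FQ _ FH; apply: h => //; exact: GH.
  by have [_ h] := FQ _ FG; apply: h => //; exact: HG.
have [A [PA AG]] : exists A, P A /\ A `<=` (fun f => f A) @` G.
  apply: contrapT => nA.
  have ex (A : set T) : exists x, P A -> A x /\ ~ ((fun f => f A) @` G) x.
    have [PA|nPA] := pselect (P A); last first.
      have [PA0e|/set0P[x _]] := eqVneq A0 set0.
        by exfalso; apply: nA; exists A0; split => //; rewrite PA0e.
      by exists x.
    apply: contrapT => nx; apply: nA; exists A; split => // x Ax.
    by apply: contrapT => nGx; apply: nx; exists x => _; split.
  have [h hP] := choice ex.
  have nGh : ~ G h by move=> Gh; have [_] := hP _ PA0; apply; exists h.
  apply: (Gmax (G `|` [set h])).
    split; first by move=> f; left.
    by move=> /(_ h) sub; apply: nGh; apply: sub; right.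
  split.
    move=> f [Gf|->] A PA; first exact: (Gin f).
    by have [] := hP _ PA.
  move=> f g [Gf|->] [Gg|->] A PA fg //.
  - exact: (Ginj _ _ _ _ A).
  - by have [_ []] := hP _ PA; exists f.
  - by have [_ []] := hP _ PA; exists g.
exists A; split => // A' PA'.
apply: card_le_trans (subset_card_le AG) _.
apply: card_le_trans (card_image_le _ _) _.
have Ginj' : set_inj G (fun f : set T -> T => f A').
  by move=> f g /set_mem Gf /set_mem Gg; exact: Ginj Gf Gg _ PA'.
have /card_eqPle[_ GA'] := inj_card_eq Ginj'.
apply: card_le_trans GA' _.
by apply: subset_card_le => x [f Gf <-]; exact: (Gin f).
Qed.

Record is_ideal (I : set (set nat)) : Prop := IsIdeal {
  ideal_sub : forall A B, A `<=` B -> I B -> I A ;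
  ideal_setU : forall A B, I A -> I B -> I (A `|` B) ;
  ideal_finite : forall A, finite_set A -> I A ;
  ideal_proper : ~ I [set: nat] }.

(* I^+ *)
Definition positive_sets (I : set (set nat)) : set (set nat) := ~` I.

Definition lambda_family (I J : set (set nat)) : set (set (nat -> set nat)) :=
  [set A | (forall B, A B -> forall n, I (B n)) /\
    forall phi : nat -> nat,
      exists B, A B /\ positive_sets J [set n | B n (phi n)]].

Definition lambda (I J : set (set nat)) : set (nat -> set nat) :=
  least_card (lambda_family I J).

Definition le_mod (I : set (set nat)) (f g : nat -> nat) : Prop :=
  I [set n | (g n < f n)%N].

Definition bounded_mod (I : set (set nat)) (A : set (nat -> nat)) : Prop :=
  exists g : nat -> nat, forall f, A f -> le_mod I f g.

Definition bnum (I : set (set nat)) : set (nat -> nat) :=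
  least_card [set A | ~ bounded_mod I A].

Lemma lambda_attained (I J : set (set nat)) :
  is_ideal I -> is_ideal J -> is_least_card (lambda_family I J) (lambda I J).
Proof.
move=> hI hJ; apply: least_cardP.
exists [set B | forall n, I (B n)]; split => // phi.
exists (fun n => [set phi n]); split.
  by move=> n; apply: ideal_finite hI _ _; exact: finite_set1.
move=> JT; apply: (ideal_proper hJ); move: JT; congr (J _).
by apply/seteqP; split.
Qed.

Lemma bnum_attained (I : set (set nat)) :
  is_ideal I -> is_least_card [set A | ~ bounded_mod I A] (bnum I).
Proof.
move=> hI; apply: least_cardP; exists setT => -[g /(_ (fun n => (g n).+1) Logic.I)].
move=> IT; apply: (ideal_proper hI); move: IT; rewrite /le_mod; congr (I _).
by apply/seteqP; split => //= n _; exact: leqnn.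
Qed.

Section Bornology.
Context {R : realType} {X : metricType R}.
Implicit Types (BB : set (set X)) (U : nat -> set X).

Record is_bornology BB : Prop := IsBornology {
  bornology_sub : forall A B, A `<=` B -> BB B -> BB A ;
  bornology_setU : forall A B, BB A -> BB B -> BB (A `|` B) ;
  bornology_cover : \bigcup_(B in BB) B = [set: X] }.

Definition is_closed_base BB BB0 : Prop :=
  [/\ BB0 `<=` BB,
      forall B, BB B -> exists B0, BB0 B0 /\ B `<=` B0 &
      forall B0, BB0 B0 -> closed B0].

Definition enlargement (B : set X) (delta : R) : set X :=
  \bigcup_(x in B) [set y | mdist x y < delta].

Definition is_open_cover U : Prop :=
  [/\ forall n, open (U n), forall n, U n <> [set: X] &
      \bigcup_n U n = [set: X]].

Definition Gamma BB : set (nat -> set X) :=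
  [set U | [/\ is_open_cover U, infinite_set (range U) &
    forall B, BB B -> exists (n0 : nat) (delta : nat -> R),
      forall n, (n0 <= n)%N ->
        0 < delta n /\ enlargement B (delta n) `<=` U n]].

Definition ideal_Gamma (I : set (set nat)) BB : set (nat -> set X) :=
  [set U | is_open_cover U /\
    forall B, BB B -> exists delta : nat -> R,
      (forall n, 0 < delta n) /\
      I [set n | ~ (enlargement B (delta n) `<=` U n)]].

(* The classes AA and CC consist of enumerated covers; the selected sets are
   members of the given covers, enumerated by n |-> a n. *)
Definition S1 (AA CC : set (nat -> set X)) : Prop :=
  forall A : nat -> nat -> set X, (forall n, AA (A n)) ->
    exists a : nat -> set X, (forall n, range (A n) (a n)) /\ CC a.

End Bornology.

(* Main.v *)
Require Import Defs.
From mathcomp Require Import all_boot all_order all_algebra.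
From mathcomp Require Import all_classical all_reals all_analysis.

Set Implicit Arguments.
Unset Strict Implicit.
Unset Printing Implicit Defensive.

Import Order.TTheory GRing.Theory Num.Theory.

Local Open Scope classical_set_scope.
Local Open Scope ring_scope.

(** Fix a sequence of covers [A n]. Choosing one member of each cover means
    choosing an index [phi n], and a base element [B] records, for every [n],
    which indices are bad for it. In (1) these are the [m] such that no
    enlargement of [B] lies in [A n m]; they form a set in [I], so [B] gives a
    sequence in [I] and the base gives at most as many of them as it has
    members. As these are fewer than [lambda I J], some [phi] meets
    each of them only on a set of [n] in [J] ([lt_least_card]). In (2) the bad indices for [B] in [A n] all
    lie below some [f B n], and fewer than [bnum I] functions [f B] have a common
    bound [phi] modulo [I]. In both cases the selected sequence is good modulo
    the ideal at each base element, and this already makes it an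
    ideal-gamma cover ([ideal_Gamma_of_base]). *)

(** The image [f @` B] is no larger than [B], so as a member of [P] it would
    have at least the cardinality of [A] and force [B] to have it too. Both
    cardinal hypotheses act only through this. *)
Lemma lt_least_card (S T : Type) (P : set (set T)) (A : set T) (B : set S)
    (f : S -> T) :
  is_least_card P A -> card_lt B A -> ~ P (f @` B).
Proof.
move=> [_ Amin] [BA neqBA] /Amin AfB; move/negP: neqBA; apply.
apply/card_eqPle; split => //.
exact: card_le_trans AfB (card_image_le _ _).
Qed.

Section Bornology.
Context {R : realType} {X : metricType R}.
Implicit Types (B : set X) (BB : set (set X)) (U : nat -> set X).

Definition strongly_inside B (V : set X) : Prop :=
  exists2 d : R, 0 < d & enlargement B d `<=` V.

Lemma enlargementS B B' (d : R) :
  B `<=` B' -> enlargement B d `<=` enlargement B' d.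
Proof. by move=> BB' y [x Bx xy]; exists x => //; exact: BB'. Qed.

Lemma sub_enlargement B (d : R) : 0 < d -> B `<=` enlargement B d.
Proof. by move=> d0 x Bx; exists x => //=; rewrite mdistxx. Qed.

Lemma strongly_insideS B B' (V : set X) :
  B `<=` B' -> strongly_inside B' V -> strongly_inside B V.
Proof.
move=> BB' [d d0 dV]; exists d => //.
exact: subset_trans (enlargementS (d := d) BB') dV.
Qed.

(** The widths [delta n] may be chosen separately for each [n], so only the
    existence of a width matters at each index. *)
Lemma ideal_widthsP (I : set (set nat)) B U : is_ideal I ->
  (exists delta : nat -> R, (forall n, 0 < delta n) /\
     I [set n | ~ (enlargement B (delta n) `<=` U n)]) <->
  I [set n | ~ strongly_inside B (U n)].
Proof.
move=> Iideal; split.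
  move=> [delta [delta0 Ibad]]; apply: ideal_sub Iideal _ _ _ Ibad.
  by move=> n /= nin sub; apply: nin; exists (delta n).
move=> Ibad.
have ex n : exists d : R,
    0 < d /\ (strongly_inside B (U n) -> enlargement B d `<=` U n).
  have [[d d0 dU]|nin] := pselect (strongly_inside B (U n)); first by exists d.
  by exists 1; split.
have [delta deltaP] := choice ex; exists delta; split.
  by move=> n; have [] := deltaP n.
apply: ideal_sub Iideal _ _ _ Ibad => n /= nsub nin.
by apply: nsub; have [_] := deltaP n; apply.
Qed.

(** Goodness modulo the ideal passes from base elements to their subsets. The
    covering property is then automatic: a point forms a bounded set, and, the
    ideal being proper, some index is good for it. *)
Lemma ideal_Gamma_of_base (I : set (set nat)) BB BB0 U :
  is_bornology BB -> is_closed_base BB BB0 -> is_ideal I ->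
  (forall n, open (U n)) -> (forall n, U n <> [set: X]) ->
  (forall B, BB0 B -> I [set n | ~ strongly_inside B (U n)]) ->
  ideal_Gamma I BB U.
Proof.
move=> born [_ base _] Iideal Uop UT goodB0.
have good B : BB B -> I [set n | ~ strongly_inside B (U n)].
  move=> /base[B0 [BB0B0 BsubB0]]; apply: ideal_sub Iideal _ _ _ (goodB0 _ BB0B0).
  by move=> n /= nB B0in; apply: nB; exact: strongly_insideS B0in.
split; last by move=> B /good; exact: (ideal_widthsP _ _ Iideal).2.
split=> //; apply/seteqP; split => // x _; apply: contrapT => xU.
have : [set: X] x by [].
rewrite -(bornology_cover born) => -[B /good Ibad Bx].
apply: (ideal_proper Iideal); apply: ideal_sub Iideal _ _ _ Ibad.
move=> n _ /= [d d0 dU]; apply: xU; exists n => //.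
by apply: dU; exact: sub_enlargement.
Qed.

Lemma S1_ideal_Gamma (I J : set (set nat)) BB BB0 :
  is_bornology BB -> is_closed_base BB BB0 -> is_ideal I -> is_ideal J ->
  card_lt BB0 (lambda I J) -> S1 (ideal_Gamma I BB) (ideal_Gamma J BB).
Proof.
move=> born base Iideal Jideal lt A GA.
pose bad B n := [set m | ~ strongly_inside B (A n m)].
have Ibad B : BB0 B -> forall n, I (bad B n).
  move=> BB0B n; have [_ GAn] := GA n; have [sub _ _] := base.
  by apply: (ideal_widthsP _ _ Iideal).1; apply: GAn; exact: sub.
have [phi phiP] : exists phi : nat -> nat,
    forall B, BB0 B -> J [set n | bad B n (phi n)].
  apply: contrapT => nphi.
  apply: (lt_least_card (f := bad) (lambda_attained Iideal Jideal) lt); split.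
    by move=> _ [B BB0B <-]; exact: Ibad.
  move=> phi; apply: contrapT => small; apply: nphi; exists phi => B BB0B.
  apply: contrapT => pos; apply: small; by exists (bad B).
exists (fun n => A n (phi n)); split; first by move=> n; exists (phi n).
apply: (ideal_Gamma_of_base born base Jideal) => // n;
  by have [[]] := GA n.
Qed.

Lemma S1_Gamma_ideal_Gamma (I : set (set nat)) BB BB0 :
  is_bornology BB -> is_closed_base BB BB0 -> is_ideal I ->
  card_lt BB0 (bnum I) -> S1 (Gamma BB) (ideal_Gamma I BB).
Proof.
move=> born base Iideal lt A GA.
have ex (Bn : set X * nat) : exists n0 : nat, BB0 Bn.1 ->
    forall m, (n0 <= m)%N -> strongly_inside Bn.1 (A Bn.2 m).
  case: Bn => B n /=; have [BB0B|nB] := pselect (BB0 B); last by exists 0%N.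
  have [sub _ _] := base; have [_ _ GAn] := GA n.
  have [n0 [delta deltaP]] := GAn _ (sub _ BB0B).
  by exists n0 => _ m /deltaP[d0 dA]; exists (delta m).
have [f fP] := choice ex.
have /contrapT[g gP] :=
  lt_least_card (f := fun B n => f (B, n)) (bnum_attained Iideal) lt.
exists (fun n => A n (g n)); split; first by move=> n; exists (g n).
apply: (ideal_Gamma_of_base born base Iideal).
- by move=> n; have [[]] := GA n.
- by move=> n; have [[]] := GA n.
move=> B BB0B.
have Ilarge : le_mod I (fun n => f (B, n)) g by apply: gP; exists B.
apply: ideal_sub Iideal _ _ _ Ilarge => n /= nin.
by rewrite ltnNge; apply/negP => /(fP (B, n) BB0B).
Qed.

End Bornology.

Theorem theorem3p5 (R : realType) (X : metricType R) (BB BB0 : set (set X))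
    (I J : set (set nat))
    (Xinf : infinite_set [set: X])
    (BBborn : is_bornology BB) (BB0base : is_closed_base BB BB0)
    (Iideal : is_ideal I) (Jideal : is_ideal J) :
  (card_lt BB0 (lambda I J) -> S1 (ideal_Gamma I BB) (ideal_Gamma J BB)) /\
  (card_lt BB0 (bnum I) -> S1 (Gamma BB) (ideal_Gamma I BB)).
Proof.
split; first exact: S1_ideal_Gamma.
exact: S1_Gamma_ideal_Gamma.
Qed.
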